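(* Let $\varphi\colon\mathbb{R}^n\times\mathbb{R}^m\to\overline{\mathbb{R}}$ be proper and lower semicontinuous, and define $$h(x):=\inf_{y\in\mathbb{R}^m}\varphi(x,y),\qquad \Psi(x):=\operatorname{argmin}_{y\in\mathbb{R}^m}\varphi(x,y),\qquad \Upsilon(x,\alpha):=\{y\in\mathbb{R}^m\mid\varphi(x,y)\le\alpha\}$$ for $x\in\mathbb{R}^n$, $\alpha\in\mathbb{R}$. Fix $\bar x\in\operatorname{dom}\Psi$ and suppose that $\Upsilon\colon\mathbb{R}^n\times\mathbb{R}\rightrightarrows\mathbb{R}^m$ is inner semicompact at $(\bar x,h(\bar x))$ with respect to $\operatorname{dom}\Upsilon$. Then for each $x^*\in\mathbb{R}^n$ and $u\in\mathbb{R}^n$, $$\text{(i)}\quad \mathrm{d}h(\bar x)(u)\ \le\ \inf_{y\in\Psi(\bar x),\,v\in\mathbb{R}^m}\mathrm{d}\varphi(\bar x,y)(u,v),$$ $$\text{(ii)}\quad \mathrm{d}^2h(\bar x;x^* )(u)\ \le\ \inf_{y\in\Psi(\bar x),\,v\in\mathbb{R}^m}\mathrm{d}^2\varphi((\bar x,y);(x^*,0))(u,v).$$ On the other hand, suppose that $\mathrm{d}h(\bar x)(u)\ge\langle x^*,u\rangle$. Then the following hold. (a) If $\mathrm{d}h(\bar x)(u)>\langle x^*,u\rangle$, then equality holds in (ii). (b) If $\mathrm{d}h(\bar x)(u)=\langle x^*,u\rangle$ and $\Upsilon$ is inner calm* at $(\bar x,h(\bar x))$ in direction $(u,\langle x^*,u\rangle)$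 with respect to $\operatorname{dom}\Upsilon$, then (i) and (ii) hold as equalities, and whenever $\mathrm{d}^2h(\bar x;x^* )(u)$ is finite, both infima are attained at some (common) pair $(y,v)\in\mathbb{R}^m\times\mathbb{R}^m$ with $y\in\Psi(\bar x)$ and $v\in D\Upsilon((\bar x,h(\bar x)),y)(u,\langle x^*,u\rangle)$.
   Context: $\overline{\mathbb{R}}:=\mathbb{R}\cup\{-\infty,\infty\}$. A function is proper if it never takes the value $-\infty$ and is finite somewhere. By convention $\Psi(x):=\varnothing$ if $\varphi(x,y)=\infty$ for all $y$. For a set-valued mapping $\Gamma$, $\operatorname{dom}\Gamma:=\{x\mid\Gamma(x)\neq\varnothing\}$. For a function $h\colon\mathbb{R}^n\to\overline{\mathbb{R}}$ and $\bar z$ with $|h(\bar z)|<\infty$, the subderivative is $\mathrm{d}h(\bar z)(w):=\liminf_{t\downarrow0,\,w'\to w}\frac{h(\bar z+tw')-h(\bar z)}{t}$, and for $z^*\in\mathbb{R}^n$ the second subderivative is $\mathrm{d}^2h(\bar z;z^* )(w):=\liminf_{t\downarrow0,\,w'\to w}\frac{h(\bar z+tw')-h(\bar z)-t\langle z^*,w'\rangle}{\frac12t^2}$. Let $\Gamma\colon\mathbb{R}^p\rightrightarrows\mathbb{R}^m$, $\Omega\subset\mathbb{R}^p$, $\bar p\in\operatorname{dom}\Gamma$. $\Gamma$ is inner semicompact at $\bar p$ w.r.t. $\Omega$ if for each sequence $p_k\to\bar p$ with $p_k\in\Omega$ for all $k$ there exist $y\in\mathbb{R}^m$, a subsequence $p_{k_\ell}$,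 and $y_\ell\to y$ with $y_\ell\in\Gamma(p_{k_\ell})$ for each $\ell$. $\Gamma$ is inner calm* at $\bar p$ in direction $q\in\mathbb{R}^p$ w.r.t. $\Omega$ if there is $\kappa>0$ such that for each sequence $p_k=\bar p+t_kq_k\in\Omega$ with $t_k\downarrow0$, $q_k\to q$, there exist $y\in\mathbb{R}^m$, a subsequence $p_{k_\ell}$, and $y_\ell\to y$ with $y_\ell\in\Gamma(p_{k_\ell})$ and $\|y_\ell-y\|\le\kappa\|p_{k_\ell}-\bar p\|$ for each $\ell$. The graphical derivative is given by: $v\in D\Gamma(\bar p,y)(q)$ iff $(q,v)\in T_{\operatorname{gph}\Gamma}(\bar p,y)$, where $T_\Omega(\bar z):=\{w\mid\exists t_k\downarrow0,\,w_k\to w\colon\bar z+t_kw_k\in\Omega\ \forall k\}$. *)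

(* Defs.v *)
From HB Require Import structures.
From mathcomp Require Import all_boot all_order all_algebra.
From mathcomp Require Import boolp classical_sets reals ereal topology normedtype.

Set Implicit Arguments.
Unset Strict Implicit.
Unset Printing Implicit Defensive.

Import Order.TTheory GRing.Theory Num.Theory.
Import numFieldNormedType.Exports.

Local Open Scope classical_set_scope.
Local Open Scope ring_scope.

(* R^n is 'rV[R]_n with its library topology; a product R^n x R^m is
   'rV[R]_(n + m), the pair (x, y) being row_mx x y, and R is identified
   with 'rV[R]_1 through const_mx. *)

Definition dot (R : realType) (n : nat) (x y : 'rV[R]_n) : R :=
  \sum_(i < n) x 0 i * y 0 i.

(* The library norm `|x| on 'rV[R]_n is the maximum norm. *)
Definition enorm (R : realType) (n : nat) (x : 'rV[R]_n) : R :=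
  Num.sqrt (dot x x).

Definition proper_ereal (R : realType) (n : nat) (f : 'rV[R]_n -> \bar R) : Prop :=
  (forall z, f z != -oo%E) /\ (exists z, f z \is a fin_num).

(* Both subderivatives are meaningful only at points zbar where h is finite.
   The liminf is over the filter of t -> 0, t > 0 and w' -> w (w' = w being
   allowed). *)
Definition subderivative (R : realType) (n : nat) (h : 'rV[R]_n -> \bar R)
    (zbar w : 'rV[R]_n) : \bar R :=
  limf_einf
    (fun s : R * 'rV[R]_n =>
       ((h (zbar + s.1 *: s.2)%R - h zbar) * (s.1^-1)%:E)%E)
    (filter_prod 0^'+ (nbhs w)).

Definition second_subderivative (R : realType) (n : nat)
    (h : 'rV[R]_n -> \bar R) (zbar zs w : 'rV[R]_n) : \bar R :=
  limf_einf
    (fun s : R * 'rV[R]_n =>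
       ((h (zbar + s.1 *: s.2)%R - h zbar - (s.1 * dot zs s.2)%:E)
          * ((2^-1 * s.1 ^+ 2)^-1)%:E)%E)
    (filter_prod 0^'+ (nbhs w)).

Definition dom_set (T U : Type) (G : T -> set U) : set T := [set x | G x !=set0].

Definition gph (R : realType) (p m : nat) (G : 'rV[R]_p -> set 'rV[R]_m) :
    set 'rV[R]_(p + m) :=
  [set z | G (lsubmx z) (rsubmx z)].

(* t_k \downarrow 0 means t_k > 0 and t_k -> 0, without monotonicity. *)
Definition downto0 (R : realType) (t : nat -> R) : Prop :=
  (forall k, 0 < t k) /\ t @ \oo --> (0 : R).

Definition tangent_cone (R : realType) (n : nat) (Omega : set 'rV[R]_n)
    (zbar : 'rV[R]_n) : set 'rV[R]_n :=
  [set w | exists (t : nat -> R) (wk : nat -> 'rV[R]_n),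
     [/\ downto0 t, wk @ \oo --> w &
         forall k, Omega (zbar + t k *: wk k)]].

Definition graphical_derivative (R : realType) (p m : nat)
    (G : 'rV[R]_p -> set 'rV[R]_m) (pbar : 'rV[R]_p) (y : 'rV[R]_m)
    (q : 'rV[R]_p) : set 'rV[R]_m :=
  [set v | tangent_cone (gph G) (row_mx pbar y) (row_mx q v)].

Definition inner_semicompact (R : realType) (p m : nat)
    (G : 'rV[R]_p -> set 'rV[R]_m) (pbar : 'rV[R]_p) (Omega : set 'rV[R]_p) :
    Prop :=
  forall pk : nat -> 'rV[R]_p,
    pk @ \oo --> pbar -> (forall k, Omega (pk k)) ->
    exists (y : 'rV[R]_m) (sigma : nat -> nat) (yl : nat -> 'rV[R]_m),
      [/\ {homo sigma : i j / (i < j)%N},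
          yl @ \oo --> y &
          forall l, G (pk (sigma l)) (yl l)].

Definition inner_calm_star (R : realType) (p m : nat)
    (G : 'rV[R]_p -> set 'rV[R]_m) (pbar q : 'rV[R]_p)
    (Omega : set 'rV[R]_p) : Prop :=
  exists2 kappa : R, 0 < kappa &
  forall (t : nat -> R) (qk : nat -> 'rV[R]_p),
    let pk := fun k => pbar + t k *: qk k in
    downto0 t -> qk @ \oo --> q -> (forall k, Omega (pk k)) ->
    exists (y : 'rV[R]_m) (sigma : nat -> nat) (yl : nat -> 'rV[R]_m),
      [/\ {homo sigma : i j / (i < j)%N},
          yl @ \oo --> y,
          forall l, G (pk (sigma l)) (yl l) &
          forall l, enorm (yl l - y) <= kappa * enorm (pk (sigma l) - pbar)].

Section Marginal.
Variables (R : realType) (n m : nat) (phi : 'rV[R]_(n + m) -> \bar R).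

Definition marginal (x : 'rV[R]_n) : \bar R :=
  ereal_inf [set phi (row_mx x y) | y in [set: 'rV[R]_m]].

(* The first conjunct is the convention that the argmin is empty when
   phi(x, .) is identically +oo. *)
Definition Psi (x : 'rV[R]_n) : set 'rV[R]_m :=
  [set y | (exists y', phi (row_mx x y') != +oo%E) /\
           (forall y', (phi (row_mx x y) <= phi (row_mx x y'))%E)].

Definition Upsilon (p : 'rV[R]_(n + 1)) : set 'rV[R]_m :=
  [set y | (phi (row_mx (lsubmx p) y) <= (rsubmx p 0 0)%:E)%E].

Definition inf_subderivative (xbar u : 'rV[R]_n) : \bar R :=
  ereal_inf [set subderivative phi (row_mx xbar y) (row_mx u v) |
              y in Psi xbar & v in [set: 'rV[R]_m]].

Definition inf_second_subderivative (xbar xs u : 'rV[R]_n) : \bar R :=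
  ereal_inf [set second_subderivative phi (row_mx xbar y)
                   (row_mx xs (0 : 'rV[R]_m)) (row_mx u v) |
              y in Psi xbar & v in [set: 'rV[R]_m]].

End Marginal.

(* Main.v *)
Require Import Defs.
From mathcomp Require Import all_boot all_order all_algebra.
From mathcomp Require Import boolp classical_sets reals ereal topology normedtype.
From mathcomp Require Import sequences ring lra.
Import Order.TTheory GRing.Theory Num.Theory.
Import numFieldNormedType.Exports.
Local Open Scope classical_set_scope.
Local Open Scope ring_scope.

(** Write h for the marginal function and hbar for h(xbar).

    The two inequalities hold because h(xbar + t u') is at most
    phi(xbar + t u', y + t v') for every v', with equality at t = 0 when y is
    a minimizer: each difference quotient of h lies below the corresponding
    quotient of phi, and as (u', v') tends to (u, v) its projection u' tends
    to u ([le_limf_einf_proj]).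

    For (a), if the second subderivative of h has a real upper bound b, then
    along suitable t -> 0, u' -> u the increment of h is at most
    t <x*, u'> + (b + o(1)) t^2 / 2; dividing by t gives
    dh(xbar)(u) <= <x*, u> ([subderivative_le_dot]). So under the strict
    inequality the second subderivative of h is +oo and (ii) is an equality.

    For (b), let b be a real upper bound of the second subderivative and take
    sequences t_k, u_k realizing it. Instead of h(xbar + t_k u_k) itself, which
    need not be attained, use as levels the explicit real numbers
      alpha_k = hbar + t_k (<x*, u_k> + t_k (b + 1/(k+1)) / 2),
    which lie strictly above it. Strictness puts (xbar + t_k u_k, alpha_k)
    in the domain of Upsilon, and these points approach (xbar, hbar) in
    direction (u, <x*, u>). Inner calmness* then yields points y_k with
    phi(xbar + t_k u_k, y_k) <= alpha_k, converging along a subsequence to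
    some y at rate O(t_k). By lower semicontinuity y is a minimizer, and
    the bounded quotients (y_k - y) / t_k accumulate at some v. The resulting
    sequence shows that v belongs to the graphical derivative, that
    dphi(xbar, y)(u, v) <= <x*, u> and that the second subderivative of phi at
    (y, v) is at most b ([calm_attainment]). A finite second subderivative of
    h may be taken as b itself, which gives the common minimizing pair; if it
    is -oo, every real b is allowed. The equality in (i), where the second
    subderivative may also be +oo, comes from the same construction with
    alpha_k = hbar + t_k (<x*, u> + 1/(k+1)). *)

(** * Euclidean space: inner product, convergence, bounded sequences *)

Section EuclideanSpace.
Context {R : realType}.
Implicit Types p n m : nat.

Lemma dotZ {n} (c : R) (x : 'rV[R]_n) : dot (c *: x) (c *: x) = c ^+ 2 * dot x x.
Proof.
by rewrite /dot mulr_sumr; apply: eq_bigr => i _; rewrite !mxE; ring.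
Qed.

Lemma dot_ge0 {n} (x : 'rV[R]_n) : 0 <= dot x x.
Proof. by apply: sumr_ge0 => i _; rewrite -expr2 sqr_ge0. Qed.

Lemma enormZ {n} (c : R) (x : 'rV[R]_n) : 0 <= c -> enorm (c *: x) = c * enorm x.
Proof. by move=> c0; rewrite /enorm dotZ sqrtrM ?sqr_ge0// sqrtr_sqr ger0_norm. Qed.

Lemma coord_le_enorm {n} (x : 'rV[R]_n) i : `|x 0 i| <= enorm x.
Proof.
rewrite -sqrtr_sqr ler_sqrt ?dot_ge0// /dot (bigD1 i)//= -expr2 lerDl.
by apply: sumr_ge0 => j _; rewrite -expr2 sqr_ge0.
Qed.

Lemma dot_row_mx0 {n m} (x a : 'rV[R]_n) (b : 'rV[R]_m) :
  dot (row_mx x 0) (row_mx a b) = dot x a.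
Proof.
rewrite /dot big_split_ord /= [X in _ + X]big1 ?addr0.
  by apply: eq_bigr => i _; rewrite !row_mxEl.
by move=> i _; rewrite !row_mxEr mxE mul0r.
Qed.

Lemma cvg_rowP {T : Type} {G : set_system T} {FG : Filter G} {p}
    (f : T -> 'rV[R]_p) (a : 'rV[R]_p) :
  f @ G --> a <-> forall i, (fun x => f x 0 i) @ G --> a 0 i.
Proof.
split=> [fa i|fa P [Q aQ QP]].
  exact: (cvg_comp _ _ fa (@coord_continuous R 1 p 0 i a)).
have : \forall x \near G, forall i, Q 0 i (f x 0 i).
  by apply: filter_forall => i; exact: (fa i _ (aQ 0 i)).
by apply: filterS => x Qx; apply: QP => i j; rewrite ord1; exact: Qx.
Qed.

Lemma cvg_row_mx {T : Type} {G : set_system T} {FG : Filter G} {n m}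
    {f : T -> 'rV[R]_n} {g : T -> 'rV[R]_m} {a : 'rV[R]_n} {b : 'rV[R]_m} :
  f @ G --> a -> g @ G --> b ->
  (fun x => row_mx (f x) (g x)) @ G --> row_mx a b.
Proof.
move=> /cvg_rowP fa /cvg_rowP gb; apply/cvg_rowP => i.
case: (split_ordP i) => j ->; rewrite ?row_mxEl ?row_mxEr.
  by under eq_fun do rewrite row_mxEl; exact: fa.
by under eq_fun do rewrite row_mxEr; exact: gb.
Qed.

Lemma cvg_const_mx {T : Type} {G : set_system T} {FG : Filter G}
    {f : T -> R} {a : R} :
  f @ G --> a -> (fun x => const_mx (f x) : 'rV[R]_1) @ G --> const_mx a.
Proof.
move=> fa; apply/cvg_rowP => i; rewrite mxE.
by under eq_fun do rewrite mxE.
Qed.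

Lemma cvg_lsubmx {n m} (z : 'rV[R]_(n + m)) :
  (fun w : 'rV[R]_(n + m) => lsubmx w) @ z --> lsubmx z.
Proof.
apply/(@cvg_rowP _ (nbhs z) (nbhs_filter z)) => i.
rewrite mxE; under eq_fun do rewrite mxE.
exact: coord_continuous.
Qed.

Lemma cvg_dot {T : Type} {G : set_system T} {FG : Filter G} {n}
    {f g : T -> 'rV[R]_n} {a b : 'rV[R]_n} :
  f @ G --> a -> g @ G --> b ->
  (fun x => dot (f x) (g x)) @ G --> dot a b.
Proof.
move=> /cvg_rowP fa /cvg_rowP gb; rewrite /dot.
by apply: cvg_big => [|i _]; [exact: add_continuous|exact: cvgM].
Qed.

Lemma cvg_enorm_bounded {n} {x : nat -> 'rV[R]_n} {a : 'rV[R]_n} :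
  x @ \oo --> a -> exists M, forall k, enorm (x k) <= M.
Proof.
move=> xa; have : cvgn (fun k => dot (x k) (x k)).
  by apply/cvg_ex; exists (dot a a); exact: cvg_dot.
move=> /cvg_seq_bounded[M [Mreal MP]].
exists (Num.sqrt (M + 1)) => k; apply: ler_wsqrtr.
by apply: le_trans (ler_norm _) _; apply: (MP (M + 1)) => //; lra.
Qed.

Lemma cvg_subsequence {T : topologicalType} {x : nat -> T} {a : T} {s : nat -> nat} :
  (forall k, (k <= s k)%N) -> x @ \oo --> a -> (x \o s) @ \oo --> a.
Proof.
move=> sk; apply: cvg_comp; apply/cvgnyPge => A; near=> k.
by apply: leq_trans (sk k); near: k; exact: nbhs_infty_ge.
Unshelve. all: by end_near. Qed.

(** A cluster point given by compactness of the cube [-M, M]^n is the limit of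
    the terms selected at the balls of radius 1/(k+1) around it. The condition
    k <= s k ensures that sequences convergent beforehand remain so along s. *)
Lemma row_bounded_subsequence {n} {x : nat -> 'rV[R]_n} {M : R} :
  (forall k i, `|x k 0 i| <= M) ->
  exists (a : 'rV[R]_n) (s : nat -> nat),
    (forall k, (k <= s k)%N) /\ (x \o s) @ \oo --> a.
Proof.
move=> xM.
have := @rV_compact R n (fun=> [set` `[- M, M]]) (fun=> @segment_compact R (- M) M).
move=> /(_ (x @ \oo) _) [|a [_ clA]].
  by exists 0%N => //= k _ i /=; rewrite in_itv /= -ler_norml.
have s_ex k : {j | (k <= j)%N /\ ball a (harmonic k) (x j)}.
  apply/cid; have [||_ [[j kj <-] ?]] :=
    clA (x @` [set j | (k <= j)%N]) (ball a (harmonic k)).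
  - by apply: filterS (nbhs_infty_ge k) => j kj; exists j.
  - exact: nbhsx_ballx (harmonic_gt0 k).
  - by exists j.
exists a, (fun k => sval (s_ex k)); split=> [k|].
  by have [] := svalP (s_ex k).
apply/cvg_ballP => e e0; near=> k.
have [_ xs] := svalP (s_ex k); apply: le_ball xs.
by near: k; apply: filterS (near_infty_natSinv_lt (PosNum e0)) => k /ltW.
Unshelve. all: by end_near. Qed.

End EuclideanSpace.

(** * Lower limits along t > 0, t -> 0, w' -> w *)

Section LowerLimits.
Context {R : realType}.

(** Extended reals are compared through real upper bounds: this treats the
    values +oo (no bound to check) and -oo (all bounds) without case split. *)
Lemma ereal_le_real_ub (x y : \bar R) :
  (forall b : R, (x <= b%:E)%E -> (y <= b%:E)%E) -> (y <= x)%E.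
Proof.
case: x => [r|_|yb]; [by apply|by rewrite leey|].
case: y yb => [r|/(_ 0)|//] yb; last by apply: yb; rewrite leNye.
by have := yb (r - 1) (leNye _); rewrite lee_fin => ?; exfalso; lra.
Qed.

Lemma limf_einf_lt {T : choiceType} {X : filteredType T} {f : X -> \bar R}
    {F : set (set X)} {b e : R} {V : set X} :
  (limf_einf f F <= b%:E)%E -> F V -> 0 < e ->
  exists2 s, V s & (f s < (b + e)%:E)%E.
Proof.
rewrite limf_einfE => fb FV e0.
have /ereal_inf_lt[_ [s Vs <-] fs] : (ereal_inf (f @` V) < (b + e)%:E)%E.
  apply: (@le_lt_trans _ _ b%:E); last by rewrite lte_fin ltrDl.
  by apply: le_trans fb; apply: ereal_sup_ubound; exists V.
by exists s.
Qed.

Lemma le_limf_einf {T : choiceType} {X : filteredType T} {f : X -> \bar R}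
    {F : set (set X)} {b : R} :
  (forall V e, F V -> 0 < e -> exists2 s, V s & (f s <= (b + e)%:E)%E) ->
  (limf_einf f F <= b%:E)%E.
Proof.
move=> fb; rewrite limf_einfE; apply: ge_ereal_sup => _ [V FV <-].
apply/lee_addgt0Pr => e e0; have [s Vs fs] := fb V e FV e0.
by apply: le_trans fs; apply: ereal_inf_lbound; exists s.
Qed.

Context {n : nat}.
Implicit Types (w : 'rV[R]_n) (f : R * 'rV[R]_n -> \bar R).

Lemma downto0_cvg_at_right {t : nat -> R} : downto0 t -> t @ \oo --> 0^'+.
Proof.
move=> [t_gt0 t0] V V0.
have : \forall k \near \oo, 0 < t k -> V (t k) by exact: t0 _ V0.
by apply: filterS => k; apply; exact: t_gt0.
Qed.

(** With [limf_einf_seq], this replaces the filter form of the lower limit by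
    sequences, the form in which inner calmness* is stated. *)
Lemma limf_einf_le_seq {f w} {b : R} {t : nat -> R} {u : nat -> 'rV[R]_n}
    {c : nat -> R} :
  downto0 t -> u @ \oo --> w -> c @ \oo --> b ->
  (forall k, (f (t k, u k) <= (c k)%:E)%E) ->
  (limf_einf f (filter_prod 0^'+ (nbhs w)) <= b%:E)%E.
Proof.
move=> t0 uw cb fc; apply: le_limf_einf => V e FV e0.
case: FV => -[A B] [/= A0 Bw] ABV.
have At : \forall k \near \oo, A (t k) by exact: downto0_cvg_at_right t0 _ A0.
have Bu : \forall k \near \oo, B (u k) by exact: uw _ Bw.
have ce : \forall k \near \oo, c k < b + e.
  by apply: cvgr_lt cb _ _; rewrite ltrDl.
have [k [[Ak Bk] ck]] := filter_ex (filterI (filterI At Bu) ce).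
exists (t k, u k); first exact: ABV.
by apply: le_trans (fc k) _; rewrite lee_fin ltW.
Qed.

(** The sequence (t_k, u_k) is picked in the shrinking neighbourhoods
    0 < t < 1/(k+1), |u - w| < 1/(k+1). The strict inequality is what later
    makes sublevel sets nonempty even if the infimum defining the marginal
    function is not attained. *)
Lemma limf_einf_seq {f w} {b : R} :
  (limf_einf f (filter_prod 0^'+ (nbhs w)) <= b%:E)%E ->
  exists (t : nat -> R) (u : nat -> 'rV[R]_n),
    [/\ downto0 t, u @ \oo --> w &
        forall k, (f (t k, u k) < (b + harmonic k)%:E)%E].
Proof.
move=> fb.
have s_ex k : {s : R * 'rV[R]_n | [/\ 0 < s.1 < harmonic k,
    ball w (harmonic k) s.2 & (f s < (b + harmonic k)%:E)%E]}.
  apply/cid.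
  have FV : filter_prod 0^'+ (nbhs w)
      [set s : R * 'rV[R]_n | 0 < s.1 < harmonic k /\ ball w (harmonic k) s.2].
    exists ([set r : R | 0 < r < harmonic k], ball w (harmonic k)) => //=.
    split; last exact: nbhsx_ballx (harmonic_gt0 k).
    near=> r; apply/andP; split; near: r; first exact: nbhs_right_gt.
    exact: nbhs_right_lt (harmonic_gt0 k).
  by have [s [? ?] ?] := limf_einf_lt fb FV (harmonic_gt0 k); exists s.
exists (fun k => (sval (s_ex k)).1), (fun k => (sval (s_ex k)).2); split.
- split=> [k|]; first by have [/andP[]] := svalP (s_ex k).
  apply: (@squeeze_cvgr _ _ _ _ (fun=> 0) harmonic); last 2 first.
    exact: cvg_cst.
    exact: cvg_harmonic.
  by near=> k; have [/andP[/ltW -> /ltW ->]] := svalP (s_ex k).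
- apply/cvg_ballP => e e0; near=> k.
  have [_ xs _] := svalP (s_ex k); apply: le_ball xs.
  by near: k; apply: filterS (near_infty_natSinv_lt (PosNum e0)) => k /ltW.
- by move=> k; case: (s_ex k) => -[? ?] [].
Unshelve. all: by end_near. Qed.

(** Projection onto the first block is continuous, so a neighbourhood of u
    pulls back to one of (u, v), on which g lies above f. *)
Lemma le_limf_einf_proj {m : nat} f (g : R * 'rV[R]_(n + m) -> \bar R)
    (u : 'rV[R]_n) (v : 'rV[R]_m) :
  (forall (t : R) (w : 'rV[R]_(n + m)), 0 < t -> (f (t, lsubmx w) <= g (t, w))%E) ->
  (limf_einf f (filter_prod 0^'+ (nbhs u))
     <= limf_einf g (filter_prod 0^'+ (nbhs (row_mx u v))))%E.
Proof.
move=> fg; rewrite !limf_einfE; apply: ge_ereal_sup => _ [V [[A B] [/= A0 Bu] ABV] <-].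
pose W := [set s : R * 'rV[R]_(n + m) | (A `&` [set r | 0 < r]) s.1 /\ B (lsubmx s.2)].
apply: (@le_trans _ _ (ereal_inf (g @` W))).
  apply: le_ereal_inf_tmp => _ [[t w] /= [[At t_gt0] Bw] <-].
  apply: le_trans (fg t w t_gt0); apply: ereal_inf_lbound.
  by exists (t, lsubmx w) => //; exact: ABV.
apply: ereal_sup_ubound; exists W => //.
exists (A `&` [set r | 0 < r], [set w | B (lsubmx w)]) => //=; split.
  by apply: filterI => //; exact: nbhs_right_gt.
have := cvg_lsubmx (row_mx u v); rewrite row_mxKl; exact.
Qed.

End LowerLimits.

(** * Difference quotients *)

Section DifferenceQuotients.
Context {R : realType} {n : nat}.
Implicit Types (h : 'rV[R]_n -> \bar R) (z zs w : 'rV[R]_n).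

(** Moving everything but the value a across the inequality also covers
    infinite a, as only real numbers are moved. In the second-order version
    t (d + t c / 2) is kept in factored form because d + t c / 2 is the slope at
    which the level (hz + t * slope) leaves hz. *)
Lemma quotient_ltE (a : \bar R) (hz t c : R) : 0 < t ->
  ((a - hz%:E) * (t^-1)%:E < c%:E)%E = (a < (hz + t * c)%:E)%E.
Proof. by move=> t0; rewrite lte_pdivrMr// lteBlDr// -EFinM -EFinD mulrC addrC. Qed.

Lemma quotient_leE (a : \bar R) (hz t c : R) : 0 < t ->
  ((a - hz%:E) * (t^-1)%:E <= c%:E)%E = (a <= (hz + t * c)%:E)%E.
Proof. by move=> t0; rewrite lee_pdivrMr// leeBlDr// -EFinM -EFinD mulrC addrC. Qed.

Lemma second_quotient_ltE (a : \bar R) (hz t d c : R) : 0 < t ->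
  ((a - hz%:E - (t * d)%:E) * ((2^-1 * t ^+ 2)^-1)%:E < c%:E)%E
    = (a < (hz + t * (d + 2^-1 * t * c))%:E)%E.
Proof.
move=> t0; rewrite lte_pdivrMr; last by rewrite mulr_gt0// exprn_gt0.
rewrite lteBlDr// lteBlDr// -EFinM -!EFinD.
by congr (_ < _%:E)%E; ring.
Qed.

Lemma second_quotient_leE (a : \bar R) (hz t d c : R) : 0 < t ->
  ((a - hz%:E - (t * d)%:E) * ((2^-1 * t ^+ 2)^-1)%:E <= c%:E)%E
    = (a <= (hz + t * (d + 2^-1 * t * c))%:E)%E.
Proof.
move=> t0; rewrite lee_pdivrMr; last by rewrite mulr_gt0// exprn_gt0.
rewrite leeBlDr// leeBlDr// -EFinM -!EFinD.
by congr (_ <= _%:E)%E; ring.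
Qed.

Lemma subderivative_seq {h z w} {hz b : R} :
  h z = hz%:E -> (subderivative h z w <= b%:E)%E ->
  exists (t : nat -> R) (u : nat -> 'rV[R]_n),
    [/\ downto0 t, u @ \oo --> w &
        forall k, (h (z + t k *: u k)%R
                     < (hz + t k * (b + harmonic k))%:E)%E].
Proof.
move=> hzE /limf_einf_seq[t [u [t0 uw tu]]]; exists t, u; split=> // k.
by have := tu k; rewrite /= hzE quotient_ltE//; case: t0.
Qed.

Lemma second_subderivative_seq {h z zs w} {hz b : R} :
  h z = hz%:E -> (second_subderivative h z zs w <= b%:E)%E ->
  exists (t : nat -> R) (u : nat -> 'rV[R]_n),
    [/\ downto0 t, u @ \oo --> w &
        forall k, (h (z + t k *: u k)%R
          < (hz + t k * (dot zs (u k) + 2^-1 * t k * (b + harmonic k)))%:E)%E].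
Proof.
move=> hzE /limf_einf_seq[t [u [t0 uw tu]]]; exists t, u; split=> // k.
by have := tu k; rewrite /= hzE second_quotient_ltE//; case: t0.
Qed.

Lemma subderivative_le_seq {h z w} {hz b : R} {t : nat -> R}
    {u : nat -> 'rV[R]_n} {c : nat -> R} :
  h z = hz%:E -> downto0 t -> u @ \oo --> w -> c @ \oo --> b ->
  (forall k, (h (z + t k *: u k)%R <= (hz + t k * c k)%:E)%E) ->
  (subderivative h z w <= b%:E)%E.
Proof.
move=> hzE t0 uw cb hc; apply: (limf_einf_le_seq t0 uw cb) => k /=.
by rewrite hzE quotient_leE ?hc//; case: t0.
Qed.

Lemma second_subderivative_le_seq {h z zs w} {hz b : R} {t : nat -> R}
    {u : nat -> 'rV[R]_n} {c : nat -> R} :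
  h z = hz%:E -> downto0 t -> u @ \oo --> w -> c @ \oo --> b ->
  (forall k, (h (z + t k *: u k)%R
     <= (hz + t k * (dot zs (u k) + 2^-1 * t k * c k))%:E)%E) ->
  (second_subderivative h z zs w <= b%:E)%E.
Proof.
move=> hzE t0 uw cb hc; apply: (limf_einf_le_seq t0 uw cb) => k /=.
by rewrite hzE second_quotient_leE ?hc//; case: t0.
Qed.

Lemma cvg_add_harmonic (b : R) : (fun k => b + harmonic k) @ \oo --> b.
Proof.
rewrite -[X in _ --> X]addr0.
by apply: cvgD; [exact: cvg_cst|exact: cvg_harmonic].
Qed.

Lemma cvg_second_order_slope {zs w} {b : R} {t : nat -> R} {u : nat -> 'rV[R]_n} :
  downto0 t -> u @ \oo --> w ->
  (fun k => dot zs (u k) + 2^-1 * t k * (b + harmonic k)) @ \oo --> dot zs w.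
Proof.
move=> [_ t0] uw; rewrite -[X in _ --> X]addr0.
apply: cvgD; first by apply: cvg_dot => //; exact: cvg_cst.
rewrite -[X in _ --> X](mul0r b) -[X in _ --> X * b](mulr0 2^-1).
by apply: cvgM (cvg_add_harmonic b); apply: cvgM => //; exact: cvg_cst.
Qed.

(** The second-order upper bound t <zs, u> + O(t^2) along a sequence is in
    particular a first-order bound with slopes tending to <zs, w>. *)
Lemma subderivative_le_dot {h z zs w} {hz b : R} :
  h z = hz%:E -> (second_subderivative h z zs w <= b%:E)%E ->
  (subderivative h z w <= (dot zs w)%:E)%E.
Proof.
move=> hzE /(second_subderivative_seq hzE)[t [u [t0 uw tu]]].
apply: (subderivative_le_seq hzE t0 uw (cvg_second_order_slope t0 uw)) => k.
exact: ltW (tu k).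
Qed.

End DifferenceQuotients.

(** * The marginal function *)

Section Marginal.
Context {R : realType} {n m : nat} {phi : 'rV[R]_(n + m) -> \bar R}.
Context {xbar : 'rV[R]_n}.
Local Notation h := (marginal phi).
Local Notation hbar := (fine (h xbar)).

Lemma marginal_le {x y} : (h x <= phi (row_mx x y))%E.
Proof. by apply: ereal_inf_lbound; exists y. Qed.

Lemma marginal_argmin {y} : Psi phi xbar y -> h xbar = phi (row_mx xbar y).
Proof.
move=> [_ ymin]; apply/eqP; rewrite eq_le marginal_le /=.
by apply: le_ereal_inf_tmp => _ [y' _ <-]; exact: ymin.
Qed.

Context (phi_proper : proper_ereal phi) (xbar_dom : dom_set (Psi phi) xbar).

Lemma marginal_fineE : h xbar = hbar%:E.
Proof.
have [y ymin] := xbar_dom; rewrite fineK// (marginal_argmin ymin) fin_numE.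
rewrite (proj1 phi_proper) /=; case: ymin => -[y' phiy'] /(_ y') /= phiyy'.
by apply: contra phiy' => /eqP yoo; move: phiyy'; rewrite yoo leye_eq.
Qed.

Lemma argmin_value {y} : Psi phi xbar y -> phi (row_mx xbar y) = hbar%:E.
Proof. by move=> /marginal_argmin <-; exact: marginal_fineE. Qed.

Lemma le_marginal_argmin {y} : (phi (row_mx xbar y) <= hbar%:E)%E -> Psi phi xbar y.
Proof.
move=> yh; split=> [|y'].
  by exists y; apply: contraTneq yh => ->; rewrite leye_eq.
by apply: le_trans yh _; rewrite -marginal_fineE marginal_le.
Qed.

Lemma marginal_translate_le {y} {t : R} {w : 'rV[R]_(n + m)} :
  (h (xbar + t *: lsubmx w)%R <= phi (row_mx xbar y + t *: w)%R)%E.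
Proof.
rewrite -{2}(hsubmxK w) scale_row_mx add_row_mx.
exact: marginal_le.
Qed.

Lemma subderivative_le_inf u :
  (subderivative h xbar u <= inf_subderivative phi xbar u)%E.
Proof.
apply: le_ereal_inf_tmp => _ [y ymin [v _ <-]].
apply: le_limf_einf_proj => t w t0 /=.
rewrite marginal_fineE (argmin_value ymin).
apply: lee_wpmul2r; first by rewrite lee_fin invr_ge0 ltW.
by apply: leeB => //; exact: marginal_translate_le.
Qed.

Lemma second_subderivative_le_inf xs u :
  (second_subderivative h xbar xs u <= inf_second_subderivative phi xbar xs u)%E.
Proof.
apply: le_ereal_inf_tmp => _ [y ymin [v _ <-]].
apply: le_limf_einf_proj => t w t0 /=.
rewrite marginal_fineE (argmin_value ymin).
have -> : dot (row_mx xs 0) w = dot xs (lsubmx w).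
  by rewrite -{1}(hsubmxK w) dot_row_mx0.
apply: lee_wpmul2r.
  by rewrite lee_fin invr_ge0 mulr_ge0// exprn_ge0// ltW.
by apply: leeD => //; apply: leeB => //; exact: marginal_translate_le.
Qed.

Context (phi_lsc : lower_semicontinuous phi).

(** From levels hbar + t_k a_k strictly above the values of the marginal
    function, inner calmness* in direction (u, c) produces near-minimizers
    y + t v_k: the estimate |y_k - y| <= kappa t_k |(u_k, a_k)| bounds
    v_k = (y_k - y) / t_k, and a second extraction makes v_k converge. *)
Lemma calm_minimizers {u : 'rV[R]_n} {c : R} {t : nat -> R}
    {uk : nat -> 'rV[R]_n} {a : nat -> R} :
  inner_calm_star (Upsilon phi) (row_mx xbar (const_mx hbar))
    (row_mx u (const_mx c)) (dom_set (Upsilon phi)) ->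
  downto0 t -> uk @ \oo --> u -> a @ \oo --> c ->
  (forall k, (h (xbar + t k *: uk k)%R < (hbar + t k * a k)%:E)%E) ->
  exists (y v : 'rV[R]_m) (s : nat -> nat) (vk : nat -> 'rV[R]_m),
    [/\ Psi phi xbar y, forall k, (k <= s k)%N, vk @ \oo --> v &
        forall k, (phi (row_mx xbar y + t (s k) *: row_mx (uk (s k)) (vk k))%R
                     <= (hbar + t (s k) * a (s k))%:E)%E].
Proof.
move=> [kappa kappa0 calm] t0 uku ac ha.
have [t_gt0 t_cvg0] := t0.
pose qk k := row_mx (uk k) (const_mx (a k)) : 'rV[R]_(n + 1).
have pkE k : row_mx xbar (const_mx hbar) + t k *: qk k
    = row_mx (xbar + t k *: uk k) (const_mx (hbar + t k * a k)).
  rewrite scale_row_mx add_row_mx; congr row_mx.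
  by apply/rowP => i; rewrite !mxE.
have qkq : qk @ \oo --> row_mx u (const_mx c).
  exact: cvg_row_mx uku (cvg_const_mx ac).
have pk_dom k : dom_set (Upsilon phi) (row_mx xbar (const_mx hbar) + t k *: qk k).
  have /ereal_inf_lt[_ [y _ <-] /ltW phiy] := ha k.
  by exists y; rewrite /Upsilon /= pkE row_mxKl row_mxKr mxE.
have [y [s [yk [s_incr yky yk_sol yk_calm]]]] := calm t qk t0 qkq pk_dom.
have s_ge k : (k <= s k)%N.
  by elim: k => // k IH; apply: leq_ltn_trans IH _; exact: s_incr.
pose vk k := (t (s k))^-1 *: (yk k - y).
have ykE k : yk k = y + t (s k) *: vk k.
  by rewrite scalerA divff ?scale1r ?gt_eqF// addrC subrK.
have phi_yk k : (phi (row_mx (xbar + t (s k) *: uk (s k))%R (yk k))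
    <= (hbar + t (s k) * a (s k))%:E)%E.
  by have := yk_sol k; rewrite /Upsilon /= pkE row_mxKl row_mxKr mxE.
have [M qkM] := cvg_enorm_bounded qkq.
have vkM k i : `|vk k 0 i| <= kappa * M.
  apply: le_trans (coord_le_enorm _ _) _.
  have t_ge0 := ltW (t_gt0 (s k)).
  rewrite enormZ ?invr_ge0// ler_pdivrMl//.
  apply: le_trans (yk_calm k) _.
  rewrite addrC addKr enormZ// mulrCA.
  by apply/ler_wpM2l/ler_wpM2l/qkM => //; exact: ltW.
have [v [s' [s'_ge vkv]]] := row_bounded_subsequence vkM.
exists y, v, (s \o s'), (vk \o s'); split=> [|k||k].
(* otherwise lower semicontinuity keeps phi above some r > hbar near
   (xbar, y), whereas the levels tend to hbar *)
- apply: le_marginal_argmin; rewrite leNgt; apply/negP => hy.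
  have [r hr phir] : exists2 r : R, hbar < r & (r%:E < phi (row_mx xbar y))%E.
    case: (phi _) hy => [r|_|//]; last by exists (hbar + 1); rewrite ?ltry ?ltrDl.
    by rewrite lte_fin => hr; exists ((hbar + r) / 2); rewrite ?lte_fin; lra.
  have [V yV rV] := phi_lsc _ _ phir.
  have ts0 := cvg_subsequence s_ge t_cvg0.
  have xyV : \forall k \near \oo, V (row_mx (xbar + t (s k) *: uk (s k)) (yk k)).
    have : (fun k => row_mx (xbar + t (s k) *: uk (s k)) (yk k)) @ \oo
        --> row_mx (xbar + 0 *: u) y.
      apply: cvg_row_mx => //; apply: cvgD; first exact: cvg_cst.
      exact: cvgZ ts0 (cvg_subsequence s_ge uku).
    by rewrite scale0r addr0 => xyk; exact: xyk _ yV.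
  have ha_lt : \forall k \near \oo, hbar + t (s k) * a (s k) < r.
    have : (fun k => hbar + t (s k) * a (s k)) @ \oo --> hbar + 0 * c.
      apply: cvgD; first exact: cvg_cst.
      exact: cvgM ts0 (cvg_subsequence s_ge ac).
    by rewrite mul0r addr0 => /cvgr_lt; exact.
  have [k [/rV rk kr]] := filter_ex (filterI xyV ha_lt).
  have := lt_le_trans rk (phi_yk k); rewrite lte_fin => kr'.
  by have := lt_trans kr' kr; rewrite ltxx.
- exact: leq_trans (s'_ge k) (s_ge _).
- exact: vkv.
- by rewrite scale_row_mx add_row_mx /= -ykE; exact: phi_yk.
Qed.

(** The sequence of [calm_minimizers] bounds both subderivatives of phi at (y, v)
    at once. When the slopes a_k carry a second-order term, the same pair (y, v)
    also controls the second subderivative; this is why the minimizers of both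
    infima can be chosen in common. *)
Lemma calm_attainment {u : 'rV[R]_n} {c : R} {t : nat -> R}
    {uk : nat -> 'rV[R]_n} {a : nat -> R} :
  inner_calm_star (Upsilon phi) (row_mx xbar (const_mx hbar))
    (row_mx u (const_mx c)) (dom_set (Upsilon phi)) ->
  downto0 t -> uk @ \oo --> u -> a @ \oo --> c ->
  (forall k, (h (xbar + t k *: uk k)%R < (hbar + t k * a k)%:E)%E) ->
  exists y v : 'rV[R]_m,
    [/\ Psi phi xbar y,
        graphical_derivative (Upsilon phi) (row_mx xbar (const_mx hbar)) y
          (row_mx u (const_mx c)) v,
        (subderivative phi (row_mx xbar y) (row_mx u v) <= c%:E)%E &
        forall (xs : 'rV[R]_n) (b : R),
          (forall k, a k = dot xs (uk k) + 2^-1 * t k * (b + harmonic k)) ->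
          (second_subderivative phi (row_mx xbar y) (row_mx xs (0 : 'rV[R]_m))
             (row_mx u v) <= b%:E)%E].
Proof.
move=> calm t0 uku ac ha.
have [y [v [s [vk [ymin s_ge vkv phik]]]]] := calm_minimizers calm t0 uku ac ha.
have ts0 : downto0 (t \o s).
  by split=> [k|]; [exact: (proj1 t0)|exact: cvg_subsequence s_ge (proj2 t0)].
have us := cvg_subsequence s_ge uku.
have as_ := cvg_subsequence s_ge ac.
have wk : (fun k => row_mx (uk (s k)) (vk k)) @ \oo --> row_mx u v.
  exact: cvg_row_mx us vkv.
have phiE := argmin_value ymin.
exists y, v; split=> // [||xs b aE].
- exists (t \o s), (fun k => row_mx (row_mx (uk (s k)) (const_mx (a (s k)))) (vk k)).
  split=> // [|k].
    exact: cvg_row_mx (cvg_row_mx us (cvg_const_mx as_)) vkv.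
  rewrite /gph /Upsilon /= !scale_row_mx !add_row_mx !row_mxKl !row_mxKr !mxE.
  by have := phik k; rewrite scale_row_mx add_row_mx.
- apply: (subderivative_le_seq phiE ts0 wk as_) => k; exact: phik.
- have bs := cvg_subsequence s_ge (cvg_add_harmonic b).
  apply: (second_subderivative_le_seq phiE ts0 wk bs) => k /=.
  by rewrite dot_row_mx0 -aE; exact: phik.
Qed.

End Marginal.

(* fine (marginal phi xbar) is h(xbar) as a real number: it is finite because
   xbar \in dom Psi and phi is proper. *)
Theorem theorem4p8 (R : realType) (n m : nat)
  (phi : 'rV[R]_(n + m) -> \bar R)
  (phi_proper : proper_ereal phi)
  (phi_lsc : lower_semicontinuous phi)
  (xbar : 'rV[R]_n)
  (xbar_dom : dom_set (Psi phi) xbar)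
  (Upsilon_semicompact :
     inner_semicompact (Upsilon phi)
       (row_mx xbar (const_mx (fine (marginal phi xbar)))) (dom_set (Upsilon phi)))
  (xs u : 'rV[R]_n) :
  [/\ (subderivative (marginal phi) xbar u <= inf_subderivative phi xbar u)%E,
      (second_subderivative (marginal phi) xbar xs u
         <= inf_second_subderivative phi xbar xs u)%E
    & ((dot xs u)%:E <= subderivative (marginal phi) xbar u)%E ->
      (((dot xs u)%:E < subderivative (marginal phi) xbar u)%E ->
         second_subderivative (marginal phi) xbar xs u
           = inf_second_subderivative phi xbar xs u)
      /\
      (subderivative (marginal phi) xbar u = (dot xs u)%:E ->
       inner_calm_star (Upsilon phi)
         (row_mx xbar (const_mx (fine (marginal phi xbar))))
         (row_mx u (const_mx (dot xs u))) (dom_set (Upsilon phi)) ->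
         [/\ subderivative (marginal phi) xbar u
               = inf_subderivative phi xbar u,
             second_subderivative (marginal phi) xbar xs u
               = inf_second_subderivative phi xbar xs u
           & second_subderivative (marginal phi) xbar xs u \is a fin_num ->
             exists y v : 'rV[R]_m,
               [/\ Psi phi xbar y,
                   graphical_derivative (Upsilon phi)
                     (row_mx xbar (const_mx (fine (marginal phi xbar)))) y
                     (row_mx u (const_mx (dot xs u))) v,
                   subderivative phi (row_mx xbar y) (row_mx u v)
                     = inf_subderivative phi xbar u
                 & second_subderivative phi (row_mx xbar y)
                     (row_mx xs (0 : 'rV[R]_m)) (row_mx u v)
                     = inf_second_subderivative phi xbar xs u]])].

Proof.
have hE := marginal_fineE phi_proper xbar_dom.
have le1 := subderivative_le_inf phi_proper xbar_dom u.
have le2 := second_subderivative_le_inf phi_proper xbar_dom xs u.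
split=> // dh_ge; split=> [dh_gt|dhE calm].
  apply/eqP; rewrite eq_le le2 /=.
  (* a real upper bound b of the second subderivative would contradict dh_gt *)
  apply: ereal_le_real_ub => b /(subderivative_le_dot hE) dh_le.
  by have := lt_le_trans dh_gt dh_le; rewrite ltxx.
have attain1 : exists y v : 'rV[R]_m, Psi phi xbar y /\
    (subderivative phi (row_mx xbar y) (row_mx u v) <= (dot xs u)%:E)%E.
  have /(subderivative_seq hE)[t [uk [t0 uku htu]]] :
    (subderivative (marginal phi) xbar u <= (dot xs u)%:E)%E by rewrite dhE.
  have [y [v [ymin _ dphi _]]] := calm_attainment phi_proper xbar_dom phi_lsc
    calm t0 uku (cvg_add_harmonic _) htu.
  by exists y, v.
have attain2 b : (second_subderivative (marginal phi) xbar xs u <= b%:E)%E ->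
    exists y v : 'rV[R]_m, [/\ Psi phi xbar y,
      graphical_derivative (Upsilon phi)
        (row_mx xbar (const_mx (fine (marginal phi xbar)))) y
        (row_mx u (const_mx (dot xs u))) v,
      (subderivative phi (row_mx xbar y) (row_mx u v) <= (dot xs u)%:E)%E &
      (second_subderivative phi (row_mx xbar y) (row_mx xs (0 : 'rV[R]_m))
         (row_mx u v) <= b%:E)%E].
  move=> /(second_subderivative_seq hE)[t [uk [t0 uku htu]]].
  have [y [v [ymin yv dphi d2phi]]] := calm_attainment phi_proper xbar_dom phi_lsc
    calm t0 uku (cvg_second_order_slope t0 uku) htu.
  by exists y, v; split=> //; exact: d2phi.
have inf1_le y v : Psi phi xbar y ->
    (inf_subderivative phi xbar u <= subderivative phi (row_mx xbar y) (row_mx u v))%E.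
  by move=> ymin; apply: ereal_inf_lbound; exists y => //; exists v.
have inf2_le y v : Psi phi xbar y ->
    (inf_second_subderivative phi xbar xs u <=
      second_subderivative phi (row_mx xbar y) (row_mx xs (0 : 'rV[R]_m))
        (row_mx u v))%E.
  by move=> ymin; apply: ereal_inf_lbound; exists y => //; exists v.
have eq1 : subderivative (marginal phi) xbar u = inf_subderivative phi xbar u.
  apply/eqP; rewrite eq_le le1 dhE /=.
  by have [y [v [ymin dphi]]] := attain1; apply: le_trans (inf1_le y v ymin) dphi.
have eq2 : second_subderivative (marginal phi) xbar xs u
    = inf_second_subderivative phi xbar xs u.
  apply/eqP; rewrite eq_le le2 /=.
  apply: ereal_le_real_ub => b /attain2[y [v [ymin _ _ d2phi]]].
  exact: le_trans (inf2_le y v ymin) d2phi.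
split=> // d2_fin.
have [|y [v [ymin yv dphi d2phi]]] :=
    attain2 (fine (second_subderivative (marginal phi) xbar xs u)).
  by rewrite fineK.
exists y, v; split=> //; apply/eqP; rewrite eq_le ?inf1_le ?inf2_le// andbT.
- by rewrite -eq1 dhE.
- by rewrite -eq2 -[leRHS]fineK.
Qed.
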